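(* Let $k\ge 2$ be an integer and let $\lambda>0$ be real. For $n=0,1,2,\dots$ let $$p_n = e^{-k\lambda}\sum_{\substack{n_1,\dots,n_k\ge 0\\ n_1+2n_2+\dots+kn_k=n}} \frac{\lambda^{n_1+\dots+n_k}}{n_1!\cdots n_k!}$$ be the probability mass function of the Poisson distribution of order $k$ with parameter $\lambda$. Then $$p_0 = e^{-k\lambda},$$ $$p_n = e^{-k\lambda}\sum_{j=1}^n \binom{n-1}{j-1}\frac{\lambda^j}{j!}\qquad (n=1,2,\dots,k),$$ and, for all integers $r\ge 1$ and $m\in\{1,\dots,k\}$, with $n=rk+m$, $$p_n = e^{-k\lambda}\left[\sum_{j=r+1}^n \binom{n-1}{j-1}\frac{\lambda^j}{j!} - \sum_{i=1}^r (-1)^{i-1}\frac{\lambda^i}{i!}\sum_{j=r+1-i}^{n-ik-1}\binom{n-ik-1}{j+i-1}\frac{\lambda^j}{j!}\right].$$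
   Context: The indices $n_1,\dots,n_k$ range over nonnegative integers. A sum whose lower limit exceeds its upper limit equals zero. For nonnegative integers $a,b$, $\binom{a}{b}$ is the usual binomial coefficient, with $\binom{a}{b}=0$ when $b>a$. *)

(* Defs.v *)
From HB Require Import structures.
From mathcomp Require Import all_boot all_order all_algebra.
From mathcomp Require Import all_classical all_reals all_analysis.
Set Implicit Arguments.
Unset Strict Implicit.
Unset Printing Implicit Defensive.
Import Order.TTheory GRing.Theory Num.Theory.
Local Open Scope ring_scope.

(* The ordinal i : 'I_k stands for the 1-based index i.+1, so that f i is
   n_{i+1} and the constraint reads n_1 + 2 n_2 + ... + k n_k = n.
   The constraint forces every n_i <= n, hence taking values in 'I_n.+1
   rather than nat loses no solution and makes the sum a finite big operator. *)
Definition poisson_order_pmf (R : realType) (k : nat) (lambda : R) (n : nat) : R :=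
  expR (- (k%:R * lambda)) *
  \sum_(f : {ffun 'I_k -> 'I_n.+1} | (\sum_(i < k) i.+1 * f i)%N == n)
     (lambda ^+ (\sum_(i < k) f i)%N / (\prod_(i < k) (f i)`!)%N%:R).

(* Main.v *)
Require Import Defs.
From HB Require Import structures.
From mathcomp Require Import all_boot all_order all_algebra.
From mathcomp Require Import all_classical all_reals all_analysis.
From mathcomp Require Import zify ring.
Set Implicit Arguments.
Unset Strict Implicit.
Unset Printing Implicit Defensive.
Import Order.TTheory GRing.Theory Num.Theory.
Local Open Scope ring_scope.

(** Write [P = X + X^2 + ... + X^k].  The multinomial sum over [n_1, ..., n_k]
    is the coefficient of [X^n] in [exp(lambda X) ... exp(lambda X^k)
    = exp(lambda P)], that is, the sum over [N] of [lambda^N / N!] times the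
    number of compositions of [n] into [N] parts of size at most [k]
    ([pmf_sum_coef]).  Since [P = X (1 - X^k) / (1 - X)], the binomial theorem
    and the negative binomial series give that number by inclusion-exclusion as
    the sum over [i] of [(-1)^i C(N, i) C(n - i k - 1, N - 1)], where [i] is
    limited by [i k < n] ([coef_composition]).

    Let [n = r k + m] with [1 <= m <= k].  The condition [i k < n] then reads
    [i <= r], and the number vanishes for [N <= r], because [N] parts add up to
    at most [N k < n].  After the two sums are exchanged, the term [i = 0] is
    the first sum of the formula.  In the others, [N = j + i] and
    [C(N, i) / N! = 1 / (i! j!)] produce the remaining double sum
    ([inclusion_exclusion_term]).  The range [1 <= n <= k] is the case [r = 0].

    Exponential and negative binomial series are replaced by polynomials, with
    equalities of coefficients up to degree [n] only. *)

(** * Truncated exponentials *)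

(** Congruence modulo [X^(n+1)]. *)
Definition eq_modX (R : nzSemiRingType) (n : nat) (p q : {poly R}) : Prop :=
  forall m, (m <= n)%N -> p`_m = q`_m.

Lemma eq_modX_mul (R : nzSemiRingType) n (p p' q q' : {poly R}) :
  eq_modX n p p' -> eq_modX n q q' -> eq_modX n (p * q) (p' * q').
Proof.
move=> pp' qq' m mn; rewrite !coefM; apply: eq_bigr => i _.
by rewrite pp' ?qq' //; have := ltn_ord i; lia.
Qed.

Lemma sum_nat_support (V : nmodType) (F : nat -> V) a b d :
  (forall j, (d <= j)%N -> F j = 0) -> (d <= b)%N ->
  \sum_(a <= j < b) F j = \sum_(a <= j < d) F j.
Proof.
move=> F0 db; rewrite (big_nat_widen _ _ _ _ _ db) [RHS]big_mkcond /=.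
apply: eq_bigr => j _; case: ltnP => // dj; exact: F0.
Qed.

(** Groups a square sum by antidiagonals; the half of the square beyond the
    diagonal [a + b = n] contributes nothing. *)
Lemma triangle_sum (V : nmodType) n (G : nat -> nat -> V) :
  (forall a b, (n < a + b)%N -> G a b = 0) ->
  \sum_(a < n.+1) \sum_(b < n.+1) G a b =
  \sum_(N < n.+1) \sum_(i < N.+1) G (N - i)%N i.
Proof.
move=> G0; rewrite exchange_big /=.
under [RHS]eq_bigr => N _ do
  rewrite (big_ord_widen n.+1 (fun i => G (N - i)%N i)) //.
rewrite [RHS](exchange_big_dep xpredT) //=; apply: eq_bigr => b _.
rewrite -(big_mkord xpredT (fun a => G a b)).
rewrite -(big_mkord (fun N => b < N.+1)%N (fun N => G (N - b)%N b)).
rewrite (@sum_nat_support _ _ _ _ (n.+1 - b)) ?leq_subr //; last first.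
  by move=> a ha; apply: G0; lia.
rewrite [RHS](@big_cat_nat _ _ _ b) //=; last by rewrite ltnW.
rewrite [X in _ = X + _]big_nat_cond [X in _ = X + _]big_pred0 ?add0r; last by move=> N /=; lia.
rewrite [RHS]big_nat_cond [RHS](eq_bigl (fun N => (b <= N < n.+1)%N)); last by move=> N /=; lia.
rewrite -big_nat -{3}[nat_of_ord b]add0n big_addn; apply: eq_bigr => a _.
by rewrite addnK.
Qed.

Definition truncexp (F : fieldType) (n : nat) (p : {poly F}) : {poly F} :=
  \sum_(a < n.+1) (a`!%:R)^-1 *: p ^+ a.

Lemma truncexp0 (F : fieldType) n : truncexp n (0 : {poly F}) = 1.
Proof.
rewrite /truncexp big_ord_recl big1 ?addr0 /=; last first.
  by move=> i _; rewrite expr0n /= scaler0.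
by rewrite expr0 fact0 invr1 scale1r.
Qed.

(** The functional equation of the exponential.  The factor ['X] in both
    arguments makes [p ^+ a * q ^+ b] divisible by [X^(a + b)], so that the
    products with [a + b > n], which the truncation at degree [n] on the right
    lacks, do not matter modulo [X^(n+1)]; the others form the binomial theorem
    along each antidiagonal. *)
Lemma truncexpD (F : numFieldType) n (p q : {poly F}) :
  eq_modX n (truncexp n ('X * p) * truncexp n ('X * q))
            (truncexp n ('X * (p + q))).
Proof.
move=> m mn.
pose G a b : F := ((a`!%:R)^-1 *: ('X * p) ^+ a * ((b`!%:R)^-1 *: ('X * q) ^+ b))`_m.
have fact_neq0 a : a`!%:R != 0 :> F by rewrite pnatr_eq0 -lt0n fact_gt0.
transitivity (\sum_(a < n.+1) \sum_(b < n.+1) G a b).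
  rewrite /truncexp mulr_suml coef_sum; apply: eq_bigr => a _.
  by rewrite mulr_sumr coef_sum.
rewrite triangle_sum; last first.
  move=> a b ab; rewrite /G -scalerAl -scalerAr !coefZ !exprMn mulrACA -exprD.
  by rewrite coefXnM (leq_ltn_trans mn ab) !mulr0.
rewrite /truncexp coef_sum; apply: eq_bigr => N _.
rewrite coefZ mulrDr exprDn coef_sum mulr_sumr; apply: eq_bigr => i _.
have iN : (i <= N)%N by rewrite -ltnS.
rewrite /G -scalerAl -scalerAr !coefZ coefMn -[X in _ = _ * X]mulr_natl !mulrA.
congr (_ * _); rewrite -(bin_fact iN) !natrM.
have bin_neq0 : 'C(N, i)%:R != 0 :> F by rewrite pnatr_eq0 -lt0n bin_gt0.
by rewrite [in RHS]invfM mulrAC mulVf // mul1r invfM mulrC.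
Qed.

Lemma truncexp_sum (F : numFieldType) n k (p : 'I_k -> {poly F}) :
  eq_modX n (\prod_(i < k) truncexp n ('X * p i))
            (truncexp n ('X * \sum_(i < k) p i)).
Proof.
elim/big_rec2: _ => [m _|i q r _ IH m mn]; first by rewrite mulr0 truncexp0.
by rewrite -truncexpD //; apply: (@eq_modX_mul _ n) mn.
Qed.

(** Expanding the product of the exponentials of [lambda X^(i+1)] yields one
    monomial for each [f], of degree the weighted sum of the [f i]; its
    coefficient is the corresponding term of the probability mass function.
    Summing the exponents first gives the right-hand side. *)
Lemma pmf_sum_coef (F : numFieldType) k n (lambda : F) :
  \sum_(f : {ffun 'I_k -> 'I_n.+1} | (\sum_(i < k) i.+1 * f i)%N == n)
     (lambda ^+ (\sum_(i < k) f i)%N / (\prod_(i < k) (f i)`!)%N%:R)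
  = \sum_(N < n.+1) lambda ^+ N / N`!%:R *
      (('X * \sum_(i < k) 'X^i : {poly F}) ^+ N)`_n.
Proof.
transitivity (\prod_(i < k) truncexp n ('X * (lambda *: 'X^i)))`_n.
  rewrite bigA_distr_bigA coef_sum big_mkcond /=; apply: eq_bigr => f _.
  rewrite (eq_bigr (fun i : 'I_k =>
    ((f i)`!%:R^-1 * lambda ^+ f i)%:P * 'X^(i.+1 * f i))); last first.
    by move=> i _; rewrite -scalerAr -exprS exprZn scalerA -exprM -mul_polyC.
  rewrite [\prod_(i < k) (_ * 'X^_)]big_split /= -rmorph_prod mul_polyC coefZ prodrXr coefXn.
  rewrite [n == _]eq_sym; case: eqP => _; last by rewrite mulr0.
  by rewrite mulr1 big_split /= prodrXr natr_prod prodfV mulrC.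
rewrite (@truncexp_sum _ n) // -scaler_sumr /truncexp coef_sum.
apply: eq_bigr => N _.
by rewrite -scalerAr exprZn scalerA coefZ mulrC [_^-1 * _]mulrC mulrC.
Qed.

(** * Counting compositions with bounded parts *)

(** Truncated form of [(1 - X)^(-N-1)], the generating series of
    [C(a + N, N)].  Multiplication by [1 - X] takes differences of consecutive
    coefficients, which lowers [N] by Pascal's rule. *)
Lemma negbin_inverse (R : comNzRingType) n N :
  eq_modX n ((1 - 'X) ^+ N.+1 * \sum_(a < n.+1) 'C(a + N, N)%:R *: 'X^a)
            (1 : {poly R}).
Proof.
have coefS M m : (m <= n)%N ->
    (\sum_(a < n.+1) 'C(a + M, M)%:R *: 'X^a : {poly R})`_m = 'C(m + M, M)%:R.
  by move=> mn; rewrite -(poly_def _ (fun a => 'C(a + M, M)%:R)) coef_poly ltnS mn.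
elim: N => [|N IH] m mn.
  rewrite expr1 mulrBl mul1r coefB coefXM !coefS ?(leq_trans (leq_pred _) mn) //.
  by rewrite !bin0 coef1; case: m {mn} => [|m]; rewrite ?subr0 ?subrr.
rewrite exprSr -mulrA -IH //; apply: (@eq_modX_mul _ n) mn => // {}m mn.
rewrite mulrBl mul1r coefB coefXM !coefS ?(leq_trans (leq_pred _) mn) //.
case: m mn => [|m] mn /=; first by rewrite !add0n !binn subr0.
by rewrite [(m.+1 + N.+1)%N]addSn binS natrD addrAC subrr add0r addSnnS.
Qed.

(** From [(X (1 - X^k) / (1 - X))^(N+1)]: choosing [i] of the factors [- X^k]
    leaves degree [n - (N + 1) - i k] for the negative binomial series. The
    restriction [i * k < n] removes the indices for which the truncated
    difference [n - i * k - 1] would be [0] and, when [N = 0], the binomial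
    coefficient would wrongly be [1]. *)
Lemma coef_composition (R : comNzRingType) k n N :
  (0 < n)%N ->
  (('X * \sum_(i < k) 'X^i : {poly R}) ^+ N.+1)`_n =
  \sum_(i < N.+2 | (i * k < n)%N)
     (-1) ^+ i * 'C(N.+1, i)%:R * 'C(n - i * k - 1, N)%:R.
Proof.
move=> n0; rewrite exprMn coefXnM; case: ltnP => [nN|Nn].
  rewrite big1 // => i ikn; rewrite [X in _ * X%:R]bin_small ?mulr0 //; lia.
set S := \sum_(a < (n - N.+1).+1) 'C(a + N, N)%:R *: 'X^a : {poly R}.
set G := \sum_(i < k) 'X^i.
(* The geometric sum lets G ^+ N.+1 be multiplied by (1 - X)^(N+1) * S, which
   is 1 up to the relevant degree. *)
have GX : (1 - 'X) * G = 1 - 'X^k :> {poly R}.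
  by rewrite -opprB mulNr -subrX1 opprB.
have -> : (G ^+ N.+1)`_(n - N.+1) = ((1 - 'X^k) ^+ N.+1 * S)`_(n - N.+1).
  rewrite -GX exprMn mulrAC mulrC -[in LHS](mulr1 (G ^+ N.+1)).
  apply: (@eq_modX_mul _ (n - N.+1)) => // m mn.
  by rewrite negbin_inverse.
rewrite exprBn mulr_suml coef_sum [RHS]big_mkcond /=; apply: eq_bigr => i _.
rewrite expr1n mulr1 -exprM mulrnAl coefMn -signr_odd.
(* The sign is a polynomial here and has to leave the coefficient extraction. *)
have -> p : ((-1) ^+ odd i * 'X^(k * i) * p)`_(n - N.+1)
    = (-1) ^+ odd i * ('X^(k * i) * p)`_(n - N.+1) :> R.
  by case: (odd i); rewrite ?expr1 ?mulN1r ?mulNr ?coefN // !expr0 !mul1r.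
rewrite signr_odd coefXnM mulnC; case: ltnP => [lt|ge].
  rewrite mulr0 mul0rn; case: ltnP => // ikn.
  rewrite [X in _ * X%:R]bin_small ?mulr0 //; lia.
rewrite ifT; last by lia.
rewrite /S -(poly_def _ (fun a => 'C(a + N, N)%:R)) coef_poly ifT; last by lia.
rewrite -[LHS]mulr_natr [RHS]mulrAC; congr (_ * 'C(_, _)%:R * _); lia.
Qed.

(** For [n] in the block [r k + 1, ..., r k + k], [i k < n] means [i <= r], and
    this bound does not exceed the range of [i] since [r <= N]. *)
Lemma coef_composition_block (R : comNzRingType) k r m N :
  (1 <= m <= k)%N -> (r <= N)%N ->
  (('X * \sum_(i < k) 'X^i : {poly R}) ^+ N.+1)`_(r * k + m) =
  \sum_(0 <= i < r.+1)
     (-1) ^+ i * 'C(N.+1, i)%:R * 'C(r * k + m - i * k - 1, N)%:R.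
Proof.
move=> mk rN; rewrite coef_composition; last by lia.
rewrite -(big_mkord (fun i => i * k < r * k + m)%N (fun i =>
  (-1) ^+ i * 'C(N.+1, i)%:R * 'C(r * k + m - i * k - 1, N)%:R)).
rewrite (big_nat_widen 0 r.+1 N.+2) //; last by lia.
apply: eq_bigl => i /=; apply/idP/idP; nia.
Qed.

(** [N] parts of size at most [k] cannot exceed [N k]: a degree bound. *)
Lemma coef_pow_large (R : comNzRingType) k n N :
  (N * k < n)%N -> (('X * \sum_(i < k) 'X^i : {poly R}) ^+ N)`_n = 0.
Proof.
move=> Nkn; apply: nth_default.
have szP : (size ('X * \sum_(i < k) 'X^i : {poly R})%R <= k.+1)%N.
  rewrite mulrC; apply: (leq_trans (size_polyMleq _ _)).
  rewrite size_polyX addn2 /= ltnS; apply: (leq_trans (size_sum _ _ _)).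
  by apply/bigmax_leqP => i _; rewrite size_polyXn.
apply: (leq_trans (size_poly_exp_leq _ _)).
nia.
Qed.

(** * The block formula *)

(** The substitution [N = j + i].  The two upper limits differ, but the binomial
    coefficient vanishes for [j >= n - i k], which both ranges reach. *)
Lemma inclusion_exclusion_term (F : numFieldType) k (lambda : F) r n i :
  (0 < k)%N -> (0 < i <= r)%N -> (r * k < n)%N ->
  \sum_(r + 1 <= N < n.+1) lambda ^+ N / N`!%:R *
     ((-1) ^+ i * 'C(N, i)%:R * 'C(n - i * k - 1, N - 1)%:R) =
  (-1) ^+ i * (lambda ^+ i / i`!%:R) *
    \sum_(r + 1 - i <= j < (n - i * k - 1).+1)
       'C(n - i * k - 1, j + i - 1)%:R * (lambda ^+ j / j`!%:R).
Proof.
move=> k0 ir rkn.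
have ikn : (i * k < n)%N by nia.
have -> : (n - i * k - 1).+1 = (n - i * k)%N by lia.
rewrite -[X in \sum_(X <= _ < _) _](@subnK i); last by lia.
rewrite big_addn (@sum_nat_support _ _ _ _ (n - i * k)); last by nia.
  rewrite mulr_sumr; apply: eq_bigr => j _.
  have fact_neq0 a : a`!%:R != 0 :> F by rewrite pnatr_eq0 -lt0n fact_gt0.
  have bin_neq0 : 'C(j + i, i)%:R != 0 :> F.
    by rewrite pnatr_eq0 -lt0n bin_gt0 leq_addl.
  have -> : (j + i)`!%:R = 'C(j + i, i)%:R * (i`!%:R * j`!%:R) :> F.
    by rewrite -!natrM -{3}(addnK i j) bin_fact ?leq_addl.
  rewrite exprD; field.
  by rewrite bin_neq0 !fact_neq0.
by move=> j hj; rewrite [X in _ * X%:R]bin_small ?mulr0 //; lia.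
Qed.

(** For [r = 0] the second sum is empty, so this also covers [1 <= n <= k]. *)
Lemma poisson_order_pmf_block (R : realType) k (lambda : R) r m n :
  (1 <= m <= k)%N -> n = (r * k + m)%N ->
  poisson_order_pmf k lambda n =
  expR (- (k%:R * lambda)) *
  (\sum_(r + 1 <= j < n.+1) 'C(n - 1, j - 1)%:R * (lambda ^+ j / j`!%:R)
   - \sum_(1 <= i < r.+1)
       (-1) ^+ (i - 1) * (lambda ^+ i / i`!%:R) *
       \sum_(r + 1 - i <= j < (n - i * k - 1).+1)
         'C(n - i * k - 1, j + i - 1)%:R * (lambda ^+ j / j`!%:R)).
Proof.
move=> mk En; rewrite /poisson_order_pmf pmf_sum_coef; congr (_ * _).
(* T i N is the inclusion-exclusion term i for compositions into N parts. *)
pose T i N : R := lambda ^+ N / N`!%:R *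
  ((-1) ^+ i * 'C(N, i)%:R * 'C(n - i * k - 1, N - 1)%:R).
transitivity (\sum_(r + 1 <= N < n.+1) \sum_(0 <= i < r.+1) T i N).
  rewrite -(big_mkord xpredT (fun N => lambda ^+ N / N`!%:R *
      (('X * \sum_(i < k) 'X^i : {poly R}) ^+ N)`_n)).
  rewrite (@big_cat_nat _ _ _ (r + 1)) //=; last by nia.
  rewrite big_nat big1 ?add0r => [|N Nr]; last first.
    by rewrite coef_pow_large ?mulr0 //; nia.
  rewrite big_nat [RHS]big_nat; apply: eq_bigr => -[|N] Nr; first by lia.
  rewrite {1}En coef_composition_block //; last by lia.
  by rewrite mulr_sumr -En; apply: eq_bigr => i _; rewrite /T subSS subn0.
rewrite exchange_big /= big_nat_recl //; congr (_ + _).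
  apply: eq_bigr => N _.
  by rewrite /T expr0 bin0 !mul1r mul0n subn0 mulrC.
rewrite -sumrN [RHS]big_add1 /=.
rewrite big_nat [RHS]big_nat; apply: eq_bigr => i ir.
rewrite /T inclusion_exclusion_term; [|lia..|nia].
by rewrite [(i.+1 - 1)%N]subn1 /= exprS mulN1r !mulNr.
Qed.

Theorem mainTheorem1 (R : realType) (k : nat) (lambda : R)
    (hk : (2 <= k)%N) (hlambda : 0 < lambda) :
  [/\ poisson_order_pmf k lambda 0 = expR (- (k%:R * lambda)),
      forall n : nat, (1 <= n <= k)%N ->
        poisson_order_pmf k lambda n =
          expR (- (k%:R * lambda)) *
          \sum_(1 <= j < n.+1) 'C(n - 1, j - 1)%:R * (lambda ^+ j / j`!%:R)
    & forall r m n : nat, (1 <= r)%N -> (1 <= m <= k)%N -> n = (r * k + m)%N ->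
        poisson_order_pmf k lambda n =
          expR (- (k%:R * lambda)) *
          (\sum_(r + 1 <= j < n.+1) 'C(n - 1, j - 1)%:R * (lambda ^+ j / j`!%:R)
           - \sum_(1 <= i < r.+1)
               (-1) ^+ (i - 1) * (lambda ^+ i / i`!%:R) *
               \sum_(r + 1 - i <= j < (n - i * k - 1).+1)
                 'C(n - i * k - 1, j + i - 1)%:R * (lambda ^+ j / j`!%:R))].
Proof.
split.
- rewrite /poisson_order_pmf pmf_sum_coef big_ord1.
  by rewrite !expr0 fact0 divr1 mul1r coef1 mulr1.
- move=> n nk; rewrite (@poisson_order_pmf_block _ _ _ 0 n) //.
  by rewrite [X in _ - X]big_geq // subr0.
- by move=> r m n _ mk En; exact: poisson_order_pmf_block mk En.
Qed.
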